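(* Let $n\ge 1$ and let $[K_n,P]$ be a decomposition of the complete graph $K_n$, i.e. $P$ is a set of induced (hence complete) subgraphs of $K_n$ such that every edge of $K_n$ belongs to exactly one member of $P$. Let $\overrightarrow{K}_n$ be the symmetric complete digraph on $V(K_n)$ without loops, and regard each $p\in P$ as the symmetric complete subdigraph of $\overrightarrow{K}_n$ on $V(p)$ (containing both arcs $(u,v)$ and $(v,u)$ for every edge $uv$ of $p$); this gives the induced decomposition $[\overrightarrow{K}_n,P]$ of the arcs of $\overrightarrow{K}_n$. Let $L$ be the set of the $n$ loops at the vertices of $K_n$, let $\overrightarrow{K}_n^*$ be $\overrightarrow{K}_n$ together with $L$, and for $p\in P$ let $p^*$ denote $p$ together with the loops at its vertices. Let $\mathcal{F}$ be a linear-factorization of $\overrightarrow{K}_n^*$. Suppose there exists a function $h\colon P\to\mathcal{F}$ such that for every $p\in P$, the arc set $(A(p)\cup L)\cap A(h(p))$ is the arc set of a linear-factor $F_p$ of $p^*$, and for any distinct $p,q\in P$, $A(F_p)\cap A(F_q)=\emptyset$. Then $\chi'([K_n,P])\le n$.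
   Context: A digraph has a finite nonempty vertex set and a set $A$ of ordered pairs (arcs); a loop is an arc $(v,v)$. A $d$-gon ($d\ge 2$) is a directed cycle with vertices $v_1,\dots,v_d$ and arcs $(v_i,v_{i+1})$ ($1\le i<d$) and $(v_d,v_1)$; a loop is a $1$-gon. The complete digraph $\overrightarrow{K}_m^*$ on $m$ vertices has all $m^2$ ordered pairs as arcs (the $m$ loops and both arcs between every pair of distinct vertices). A linear-factor of a complete digraph with loops on $m$ vertices is a subdigraph with all $m$ vertices and exactly $m$ arcs that is a union of pairwise vertex-disjoint $d$-gons ($d\ge1$). A linear-factorization of $\overrightarrow{K}_n^*$ is a set of pairwise arc-disjoint linear-factors whose arc sets partition the arcs of $\overrightarrow{K}_n^*$. For a decomposition $[G,P]$ of a simple graph $G$, a $k$-$P$-coloring is a surjective map from $E(G)$ to a $k$-set of colors such that all edges of each $H\in P$ receive the same color, and whenever $H_1\neq H_2\in P$ share a vertex, $E(H_1)$ and $E(H_2)$ receive different colors. The chromatic index $\chi'([G,P])$ is the smallest $k$ for which a $k$-$P$-coloring exists. *)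

(* Defs.v *)
(* MathComp. *)
From mathcomp Require Import all_boot.

Set Implicit Arguments.
Unset Strict Implicit.
Unset Printing Implicit Defensive.

Section Graphs.
Variable T : finType.
Implicit Types (V : {set T}).

(* Graphs and digraphs are bare pairs inside an ambient finite type, so that  *)
(* they form finTypes and sets of them can be written {set graph T}.  An edge *)
(* uv is the two-element set [set u; v]; an arc (u, v) is the ordered pair.   *)
Definition graph := ({set T} * {set {set T}})%type.
Definition digraph := ({set T} * {set T * T})%type.

Definition gverts (G : graph) : {set T} := G.1.
Definition edges (G : graph) : {set {set T}} := G.2.
Definition dverts (D : digraph) : {set T} := D.1.
Definition arcs (D : digraph) : {set T * T} := D.2.

Definition simple_graph (G : graph) : bool :=
  (gverts G != set0) &&
  [forall e in edges G, (e \subset gverts G) && (#|e| == 2)].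

Definition complete_graph V : graph :=
  (V, [set e : {set T} | (e \subset V) && (#|e| == 2)]).

Definition induced_subgraph (H G : graph) : bool :=
  [&& gverts H != set0, gverts H \subset gverts G &
      edges H == [set e in edges G | e \subset gverts H]].

(* Members of P without edges (single vertices) are allowed. *)
Definition decomposition (G : graph) (P : {set graph}) : bool :=
  [&& simple_graph G,
      [forall H in P, induced_subgraph H G] &
      [forall e in edges G, #|[set H in P | e \in edges H]| == 1]].

(* The domain of a coloring is the finite type of edges of G, which may be    *)
(* empty, in which case k = 0.                                                *)
Definition P_coloring (G : graph) (P : {set graph}) (k : nat)
    (c : {e | e \in edges G} -> 'I_k) : bool :=
  [&& [forall i, exists e, c e == i],
      [forall H in P, forall e, forall f,
         (val e \in edges H) && (val f \in edges H) ==> (c e == c f)] &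
      [forall H1 in P, forall H2 in P,
         (H1 != H2) && ~~ [disjoint gverts H1 & gverts H2] ==>
         [forall e, forall f,
            (val e \in edges H1) && (val f \in edges H2) ==> (c e != c f)]]].

Definition P_colorable (G : graph) (P : {set graph}) (k : nat) : bool :=
  [exists c : {ffun {e | e \in edges G} -> 'I_k}, P_coloring P c].

Lemma decomposition_P_colorable (G : graph) (P : {set graph}) :
  decomposition G P -> exists k, P_colorable G P k.
Proof.
case/and3P=> _ _ /forall_inP decP.
pose E : finType := {e | e \in edges G}.
pose m (e : E) : {set graph} := [set H in P | val e \in edges H].
have mP (e : E) H : H \in P -> val e \in edges H -> m e = [set H].
  move=> HP eH; have /cards1P[H' mE] : #|m e| == 1 by apply: decP; apply: valP.
  have : H \in m e by rewrite inE HP.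
  by rewrite mE inE => /eqP ->.
pose C : finType := {x | x \in codom m}.
pose c0 (e : E) : C := exist _ (m e) (codom_f m e).
pose c : {ffun E -> 'I_#|C|} := [ffun e => enum_rank (c0 e)].
have cE e f : (c e == c f) = (m e == m f).
  by rewrite !ffunE (inj_eq enum_rank_inj) -val_eqE.
exists #|C|; apply/existsP; exists c; apply/and3P; split.
- apply/forallP=> i; have /codomP[e ie] := valP (enum_val i).
  apply/existsP; exists e; rewrite ffunE -(enum_valK i) (inj_eq enum_rank_inj).
  by rewrite -val_eqE /= ie.
- apply/forall_inP=> H HP; apply/forallP=> e; apply/forallP=> f.
  by apply/implyP=> /andP[eH fH]; rewrite cE (mP e H) // (mP f H).
apply/forall_inP=> H1 H1P; apply/forall_inP=> H2 H2P.
apply/implyP=> /andP[neqH _]; apply/forallP=> e; apply/forallP=> f.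
apply/implyP=> /andP[eH fH]; rewrite cE (mP e H1) // (mP f H2) //.
by apply: contraNneq neqH => /set1_inj ->.
Qed.

Definition chromatic_index (G : graph) (P : {set graph})
    (decP : decomposition G P) : nat :=
  ex_minn (decomposition_P_colorable decP).

Definition sym_digraph (G : graph) : digraph :=
  (gverts G, [set a : T * T | [set a.1; a.2] \in edges G]).

Definition loops V : {set T * T} := [set (v, v) | v in V].

Definition add_loops (D : digraph) : digraph :=
  (dverts D, arcs D :|: loops (dverts D)).

(* [next s] is the cyclic successor in s, so s = [:: v] yields the loop (v, v).*)
Definition is_gon (C : digraph) : Prop :=
  exists s : seq T,
    [/\ s != [::], uniq s, dverts C = [set:: s] &
        arcs C = [set (v, next s v) | v in s]].

Definition linear_factor (D F : digraph) : Prop :=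
  [/\ dverts F = dverts D, arcs F \subset arcs D, #|arcs F| = #|dverts D| &
      exists S : {set digraph},
        [/\ forall C, C \in S -> is_gon C,
            {in S &, forall C C', C != C' -> [disjoint dverts C & dverts C']},
            dverts F = \bigcup_(C in S) dverts C &
            arcs F = \bigcup_(C in S) arcs C]].

Definition linear_factorization (D : digraph) (Fs : {set digraph}) : Prop :=
  [/\ forall F, F \in Fs -> linear_factor D F,
      {in Fs &, forall F F', F != F' -> [disjoint arcs F & arcs F']} &
      partition [set arcs F | F in Fs] (arcs D)].

End Graphs.

(* Main.v *)
(* At every vertex of its digraph a linear-factor has exactly one outgoing     *)
(* arc.  If distinct p, q in P share a vertex v and h p = h q, then the arcs   *)
(* leaving v in F_p and F_q are both the arc leaving v in h p, contradicting   *)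
(* that F_p and F_q are arc-disjoint; so coloring the edges of p with h p is   *)
(* proper.  As the members of Fs are arc-disjoint and each has an arc leaving  *)
(* a fixed vertex v, there are at most n of them.                              *)
Require Import Defs.
From mathcomp Require Import all_boot.

(** The members of [Fs] serve as colors, an edge of [p] receiving [h p]. Everything rests on a
    linear-factor having exactly one arc out of each vertex ([linear_factor_out_arc],
    [linear_factor_out_arc_inj]): this makes the coloring proper and bounds the number of colors
    ([card_linear_factorization]). [chromatic_index_le_card] turns such a labelling of [P] into a
    bound on the chromatic index. *)

Lemma linear_factor_out_arc {T : finType} {D F : digraph T} {v : T} :
  linear_factor D F -> v \in dverts D -> exists w, (v, w) \in arcs F.
Proof.
case=> <- _ _ [S [gonS _ -> ->]] /bigcupP[C CS vC].
have [s [_ _ sV sA]] := gonS C CS.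
exists (next s v); apply/bigcupP; exists C => //.
by rewrite sA; apply/imsetP; exists v => //; move: vC; rewrite sV inE.
Qed.

(** A gon with an arc leaving [v] contains [v], so disjointness puts both arcs in one gon, where the
    only possible head is [next s v]. *)
Lemma linear_factor_out_arc_inj {T : finType} {D F : digraph T} {v w w' : T} :
  linear_factor D F -> (v, w) \in arcs F -> (v, w') \in arcs F -> w = w'.
Proof.
case=> _ _ _ [S [gonS disS _ ->]] /bigcupP[C CS vwC] /bigcupP[C' CS' vwC'].
have tail B u : B \in S -> (v, u) \in arcs B -> v \in dverts B.
  move=> BS; have [s [_ _ -> ->]] := gonS B BS.
  by case/imsetP=> x xs [-> _]; rewrite inE.
have eqC : C = C'.
  apply/eqP/negPn/negP=> /(disS _ _ CS CS')/pred0P/(_ v) /=.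
  by rewrite (tail _ _ CS vwC) (tail _ _ CS' vwC').
subst C'; have [s [_ _ _ sA]] := gonS C CS.
move: vwC vwC'; rewrite sA.
by case/imsetP=> x _ [-> ->] /imsetP[y _ [-> ->]].
Qed.

Lemma card_linear_factorization {T : finType} {D : digraph T}
    {Fs : {set digraph T}} (v : T) :
  linear_factorization D Fs -> v \in dverts D -> #|Fs| <= #|T|.
Proof.
case=> facF disF _ vD.
(* The default [v] is never reached on [Fs]. Two members with the same [out] share an arc, so [out]
   is injective on [Fs]. *)
pose out (F : digraph T) := odflt v [pick w | (v, w) \in arcs F].
have outP F : F \in Fs -> (v, out F) \in arcs F.
  move=> FF; rewrite /out; case: pickP => //= no_out.
  have [w vw] := linear_factor_out_arc (facF F FF) vD.
  by have := no_out w; rewrite vw.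
rewrite -(card_in_imset (f := out)) ?max_card // => F F' FF FF' eq_out.
apply/eqP/negPn/negP=> /(disF _ _ FF FF')/pred0P/(_ (v, out F)) /=.
by rewrite outP // eq_out outP.
Qed.

(** Each edge lies in exactly one member of [P] and inherits its label under [f]. *)
Lemma chromatic_index_le_card {T U : finType} {G : graph T}
    {P : {set graph T}} (decP : decomposition G P) {A : {set U}}
    (f : graph T -> U) :
    {in P, forall p, f p \in A} ->
    {in P &, forall p q,
       p != q -> ~~ [disjoint gverts p & gverts q] -> f p != f q} ->
  chromatic_index decP <= #|A|.
Proof.
move=> fA fP; rewrite /chromatic_index; case: ex_minnP => k _ min_k.
have /and3P[_ _ /forall_inP cov] := decP.
pose E : finType := {e | e \in edges G}.
have memE (e : E) : exists p, [set H in P | val e \in edges H] = [set p].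
  exact/cards1P/cov/(valP e).
have [m mE] := fin_all_exists memE.
have mP e : m e \in P.
  by have := set11 (m e); rewrite -(mE e) inE => /andP[].
have m_uniq (e : E) p : p \in P -> val e \in edges p -> m e = p.
  move=> pP ep; have : p \in [set H in P | val e \in edges H] by rewrite inE pP.
  by rewrite mE inE => /eqP.
pose g e := f (m e).
(* A coloring must be surjective, so only the labels attained on edges are kept as colors. *)
pose C : finType := {x | x \in codom g}.
pose c : {ffun E -> 'I_#|C|} :=
  [ffun e => enum_rank (exist _ (g e) (codom_f g e) : C)].
have cE e e' : (c e == c e') = (g e == g e').
  by rewrite !ffunE (inj_eq enum_rank_inj) -val_eqE.
have leC : #|C| <= #|A|.
  rewrite card_sig; apply/subset_leq_card/subsetP=> x.
  by rewrite inE => /codomP[e ->]; apply: fA.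
apply: leq_trans leC; apply: min_k; apply/existsP; exists c.
apply/and3P; split.
- apply/forallP=> i; have /codomP[e ie] := valP (enum_val i).
  apply/existsP; exists e; rewrite ffunE -(enum_valK i) (inj_eq enum_rank_inj).
  by rewrite -val_eqE /= ie.
- apply/forall_inP=> p pP; apply/forallP=> e; apply/forallP=> e'.
  apply/implyP=> /andP[ep e'p].
  by rewrite cE /g (m_uniq e p) // (m_uniq e' p).
apply/forall_inP=> p pP; apply/forall_inP=> q qP.
apply/implyP=> /andP[neq_pq meet_pq]; apply/forallP=> e; apply/forallP=> e'.
apply/implyP=> /andP[ep e'q].
by rewrite cE /g (m_uniq e p) // (m_uniq e' q) // fP.
Qed.

Theorem theorem1 (n : nat) (hn : 1 <= n)
    (P : {set graph 'I_n}) (decP : decomposition (complete_graph [set: 'I_n]) P)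
    (Fs : {set digraph 'I_n})
    (hFs : linear_factorization
             (add_loops (sym_digraph (complete_graph [set: 'I_n]))) Fs)
    (hh : exists (h : graph 'I_n -> digraph 'I_n)
                 (F_ : graph 'I_n -> digraph 'I_n),
        [/\ forall p, p \in P -> h p \in Fs,
            forall p, p \in P ->
              linear_factor (add_loops (sym_digraph p)) (F_ p) /\
              arcs (F_ p)
                = (arcs (sym_digraph p) :|: loops [set: 'I_n]) :&: arcs (h p) &
            forall p q, p \in P -> q \in P -> p != q ->
              arcs (F_ p) :&: arcs (F_ q) = set0]) :
  chromatic_index decP <= n.
Proof.
have [h [F_ [hF FP disF]]] := hh.
have le_Fs : #|Fs| <= n.
  rewrite -[leqRHS]card_ord.
  (* Since [1 <= n], vertex 0 exists and can be the fixed vertex. *)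
  by apply: (card_linear_factorization (Ordinal hn) hFs); rewrite inE.
apply: leq_trans le_Fs; apply: (chromatic_index_le_card _ h) => //.
move=> p q pP qP neq_pq /pred0Pn[v /andP[/= vp vq]].
apply/negP=> /eqP eq_h.
have [facp Ap] := FP p pP; have [facq Aq] := FP q qP.
have [w vw] := linear_factor_out_arc facp vp.
have [w' vw'] := linear_factor_out_arc facq vq.
have vwh : (v, w) \in arcs (h p) by move: vw; rewrite Ap => /setIP[].
have vwh' : (v, w') \in arcs (h p).
  by move: vw'; rewrite Aq eq_h => /setIP[].
have [fach _ _] := hFs.
have eq_w := linear_factor_out_arc_inj (fach _ (hF p pP)) vwh vwh'.
have : (v, w) \in arcs (F_ p) :&: arcs (F_ q) by rewrite inE vw eq_w.
by rewrite disF // inE.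
Qed.
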